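(* A De Morgan clone $\mathsf C$ with $\mathsf{DMA}\subseteq\mathsf C$ is protoalgebraic if and only if it contains one of the functions $\Box x$, $x\leftrightarrow_{\mathrm{t\text-min}}y$, $x\leftrightarrow_{\mathrm{i\text-min}}y$.
   Context: Let $\mathrm{DM}_4=\{\mathsf t,\mathsf f,\mathsf n,\mathsf b\}$. The truth order $\le$ has $\mathsf f$ least, $\mathsf t$ greatest, $\mathsf n,\mathsf b$ incomparable; $\wedge,\vee$ are its meet and join. De Morgan negation: $-\mathsf t=\mathsf f$, $-\mathsf f=\mathsf t$, $-\mathsf n=\mathsf n$, $-\mathsf b=\mathsf b$. A De Morgan function is a map $\mathrm{DM}_4^n\to\mathrm{DM}_4$, $n\ge1$; a De Morgan clone is a set of such functions closed under composition and containing all projections; constants are unary constant functions. $\mathsf{DMA}$ is the clone generated by $\wedge,\vee,\mathsf t,\mathsf f,-$. $\Box a=\mathsf t$ if $a=\mathsf t$, else $\mathsf f$; $a\leftrightarrow_{\mathrm{t\text-min}}b=\mathsf b$ if $a=b$, else $\mathsf f$; $a\leftrightarrow_{\mathrm{i\text-min}}b=\mathsf t$ if $a=b$, else $\mathsf n$. For a De Morgan clone $\mathsf C$ and sets $\Gamma(\overline x),\Theta(\overline x)\subseteq\mathsf C$ of functions in variables $\overline x$, write $\Gamma(\overline x)\vdash\Theta(\overline x)$ if for every tuple $\overline a$ of elements of $\mathrm{DM}_4$, $\Gamma(\overline a)\subseteq\{\mathsf t,\mathsf b\}$ implies $\Theta(\overline a)\subseteq\{\mathsf t,\mathsf b\}$.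 $\mathsf C$ is protoalgebraic if there is a set $\Delta(x,y)\subseteq\mathsf C$ of binary functions with $\emptyset\vdash\Delta(x,x)$ and $x,\Delta(x,y)\vdash y$. *)

(* Defs.v *)
From HB Require Import structures.
From mathcomp Require Import all_boot all_order.
From mathcomp Require Import boolp classical_sets.

Set Implicit Arguments.
Unset Strict Implicit.
Unset Printing Implicit Defensive.

Local Open Scope classical_set_scope.

Inductive DM4 : Type := DMt | DMf | DMn | DMb.

Definition DM4_code (a : DM4) : bool * bool :=
  match a with
  | DMt => (true, false) | DMf => (false, true)
  | DMn => (false, false) | DMb => (true, true)
  end.

Definition DM4_decode (c : bool * bool) : DM4 :=
  match c with
  | (true, false) => DMt | (false, true) => DMf
  | (false, false) => DMn | (true, true) => DMb
  end.

Lemma DM4_codeK : cancel DM4_code DM4_decode.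
Proof. by case. Qed.

HB.instance Definition _ := Finite.copy DM4 (can_type DM4_codeK).

Definition truth_le (a b : DM4) : bool := [|| a == DMf, b == DMt | a == b].

Definition truth_meet (a b : DM4) : DM4 :=
  if truth_le a b then a else if truth_le b a then b else DMf.

Definition truth_join (a b : DM4) : DM4 :=
  if truth_le a b then b else if truth_le b a then a else DMt.

Lemma truth_le_refl : reflexive truth_le.
Proof. by case. Qed.

Lemma truth_le_anti : antisymmetric truth_le.
Proof. by case; case. Qed.

Lemma truth_le_trans : transitive truth_le.
Proof. by case; case; case. Qed.

Fact truth_display : Order.disp_t.
Proof. exact: (Order.Disp tt tt). Qed.

HB.instance Definition _ := Order.Le_isPOrder.Build truth_display DM4
  truth_le_refl truth_le_anti truth_le_trans.

Lemma truth_meetP (a b c : DM4) :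
  (a <= truth_meet b c)%O = (a <= b)%O && (a <= c)%O.
Proof. by case: a; case: b; case: c. Qed.

Lemma truth_joinP (a b c : DM4) :
  (truth_join a b <= c)%O = (a <= c)%O && (b <= c)%O.
Proof. by case: a; case: b; case: c. Qed.

HB.instance Definition _ := Order.POrder_MeetJoin_isLattice.Build
  truth_display DM4 truth_meetP truth_joinP.

Definition dm_neg (a : DM4) : DM4 :=
  match a with DMt => DMf | DMf => DMt | DMn => DMn | DMb => DMb end.

Definition box (a : DM4) : DM4 := if a == DMt then DMt else DMf.

Definition iff_tmin (a b : DM4) : DM4 := if a == b then DMb else DMf.

Definition iff_imin (a b : DM4) : DM4 := if a == b then DMt else DMn.

(* Finite functions, so that Leibniz equality of De Morgan functions is
   extensional equality.  The requirement that arities be positive is part of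
   is_clone below. *)
Definition dmfun (n : nat) : Type := {ffun n.-tuple DM4 -> DM4}.

Definition dmproj (n : nat) (i : 'I_n) : dmfun n :=
  [ffun a : n.-tuple DM4 => tnth a i].

Definition dmcomp (n m : nat) (f : dmfun n) (g : 'I_n -> dmfun m) : dmfun m :=
  [ffun a : m.-tuple DM4 => f [tuple g i a | i < n]].

Definition unary (f : DM4 -> DM4) : dmfun 1 :=
  [ffun a : 1.-tuple DM4 => f (tnth a ord0)].

Definition binary (f : DM4 -> DM4 -> DM4) : dmfun 2 :=
  [ffun a : 2.-tuple DM4 => f (tnth a ord0) (tnth a ord_max)].

(* C n is the set of n-ary members of the family C. *)
Definition dmfamily : Type := forall n : nat, set (dmfun n).

Definition subfamily (C D : dmfamily) : Prop := forall n : nat, C n `<=` D n.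

Record is_clone (C : dmfamily) : Prop := IsClone {
  clone_arity : forall (n : nat) (f : dmfun n), C n f -> 0 < n;
  clone_proj : forall (n : nat) (i : 'I_n), C n (dmproj i);
  clone_comp : forall (n m : nat) (f : dmfun n) (g : 'I_n -> dmfun m),
    C n f -> (forall i : 'I_n, C m (g i)) -> C m (dmcomp f g)
}.

Definition clone_generated (G : dmfamily) : dmfamily := fun n =>
  [set f | forall C : dmfamily, is_clone C -> subfamily G C -> C n f].

Inductive DMA_generator : forall n : nat, dmfun n -> Prop :=
| DMA_meet : DMA_generator (binary (@Order.meet truth_display DM4))
| DMA_join : DMA_generator (binary (@Order.join truth_display DM4))
| DMA_true : DMA_generator (unary (fun=> DMt))
| DMA_false : DMA_generator (unary (fun=> DMf))
| DMA_neg : DMA_generator (unary dm_neg).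

Definition DMA : dmfamily := clone_generated DMA_generator.

Definition designated : set DM4 := [set DMt; DMb].

Definition entails (n : nat) (Gamma Theta : set (dmfun n)) : Prop :=
  forall a : n.-tuple DM4,
    [set g a | g in Gamma] `<=` designated ->
    [set h a | h in Theta] `<=` designated.

Definition var_x : dmfun 2 := dmproj ord0.
Definition var_y : dmfun 2 := dmproj ord_max.

(* The set of unary functions Delta(x, x). *)
Definition diagonal (Delta : set (dmfun 2)) : set (dmfun 1) :=
  [set dmcomp d (fun=> dmproj ord0) | d in Delta].

Definition protoalgebraic (C : dmfamily) : Prop :=
  exists Delta : set (dmfun 2),
    [/\ Delta `<=` C 2,
        entails set0 (diagonal Delta) &
        entails (var_x |` Delta) [set var_y]].

(* Main.v *)
(** From a set Delta witnessing protoalgebraicity one gets a binary function [e]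
of the clone that takes a designated value exactly on the diagonal: the conjunction
[d] of four members of Delta separates every designated x from every undesignated y, and
[d(x,y) /\ d(y,x) /\ d(-x,-y) /\ d(-y,-x)] separates all distinct elements.
If [e(t,t) = b], the constant b is in the clone and [e(x,y) /\ b] is the t-minimal
biconditional; if [e(t,f) = n], the constant n is in the clone and [e(x,y) \/ n]
is the i-minimal one.  Otherwise [e(t,t) = t] and [e(t,f) = f], and
[x /\ e(x,t) /\ -e(x,-x)] is the box. *)
Require Import Defs.
From mathcomp Require Import all_boot all_order.
From mathcomp Require Import boolp classical_sets.

Set Implicit Arguments.
Unset Strict Implicit.
Unset Printing Implicit Defensive.

Local Open Scope classical_set_scope.

Local Notation meet := (@Order.meet truth_display DM4).
Local Notation join := (@Order.join truth_display DM4).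

Definition is_designated (a : DM4) : bool := (a == DMt) || (a == DMb).

Lemma designatedE (a : DM4) : designated a <-> is_designated a.
Proof.
by rewrite /designated /is_designated; split;
  [case=> -> | case/orP=> /eqP ->; [left | right]].
Qed.

Lemma is_designated_meet (a b : DM4) :
  is_designated (meet a b) = is_designated a && is_designated b.
Proof. by case: a; case: b. Qed.

Definition pair_tuple (x y : DM4) : 2.-tuple DM4 := [tuple x; y].

Lemma pair_tuple_eta (a : 2.-tuple DM4) :
  pair_tuple (tnth a ord0) (tnth a ord_max) = a.
Proof.
apply: eq_from_tnth => i; case: (unliftP ord0 i) => [j ->|-> //].
by rewrite (ord1 j) (_ : lift ord0 ord0 = ord_max) //; apply/val_inj.
Qed.

Lemma binary_eta (d : dmfun 2) : binary (fun x y => d (pair_tuple x y)) = d.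
Proof. by apply/ffunP => a; rewrite ffunE pair_tuple_eta. Qed.

(** A binary tuple is just a pair of values, so both conditions become statements about elements of
    [DM4], which can be checked by cases. *)
Lemma protoalgebraicP (Delta : set (dmfun 2)) :
  (entails set0 (Defs.diagonal Delta) <->
     forall d x, Delta d -> is_designated (d (pair_tuple x x))) /\
  (entails (var_x |` Delta) [set var_y] <->
     forall x y, is_designated x ->
       (forall d, Delta d -> is_designated (d (pair_tuple x y))) ->
       is_designated y).
Proof.
have diagE (d : dmfun 2) (a : 1.-tuple DM4) :
    dmcomp d (fun=> dmproj ord0) a = d (pair_tuple (tnth a ord0) (tnth a ord0)).
  rewrite ffunE -[X in d X]pair_tuple_eta !tnth_mktuple.
  by rewrite !ffunE.
split; split.
- move=> dg d x Dd; apply/designatedE; apply: (dg [tuple x]) => [_ [? []]|].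
  by exists (dmcomp d (fun=> dmproj ord0)); [exists d | rewrite diagE].
- move=> dg a _ _ [_ [d Dd <-] <-]; rewrite diagE.
  by apply/designatedE; apply: dg.
- move=> mp x y dx Dxy; apply/designatedE.
  apply: (mp (pair_tuple x y)); last by exists var_y; rewrite ?ffunE.
  move=> _ [g [->|Dg] <-]; apply/designatedE; first by rewrite ffunE.
  exact: Dxy.
- move=> mp a Da _ [_ -> <-]; apply/designatedE; rewrite ffunE.
  apply: (mp (tnth a ord0)) => [|d Dd]; apply/designatedE; apply: Da.
    by exists var_x; [left | rewrite ffunE].
  by exists d; [right | rewrite pair_tuple_eta].
Qed.

(** * Closure of a clone above [DMA] under pointwise operations *)

Section DeMorganClone.

Variables (C : dmfamily) (hC : is_clone C) (hDMA : subfamily DMA C).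

Lemma DMA_generator_in (n : nat) (f : dmfun n) : DMA_generator f -> C f.
Proof. by move=> Gf; apply: hDMA => C' _ sub; apply: sub. Qed.

Lemma clone_unary (n : nat) (f : DM4 -> DM4) (g : n.-tuple DM4 -> DM4) :
  C (unary f) -> C (finfun g) -> C [ffun a => f (g a)].
Proof.
move=> Cf Cg; have := clone_comp hC Cf (fun=> Cg).
congr (C _); apply/ffunP => a.
by rewrite !ffunE tnth_mktuple.
Qed.

Lemma clone_binary (n : nat) (f : DM4 -> DM4 -> DM4)
    (g h : n.-tuple DM4 -> DM4) :
  C (binary f) -> C (finfun g) -> C (finfun h) ->
  C [ffun a => f (g a) (h a)].
Proof.
move=> Cf Cg Ch.
have Cgh (i : 'I_2) : C (if i == ord0 then finfun g else finfun h).
  by case: ifP.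
have := clone_comp hC Cf Cgh; congr (C _); apply/ffunP => a.
by rewrite !ffunE !tnth_mktuple /= !ffunE.
Qed.

Lemma clone_var (n : nat) (i : 'I_n) :
  C [ffun a : n.-tuple DM4 => tnth a i].
Proof. exact: (clone_proj hC i). Qed.

Lemma clone_meet (n : nat) (g h : n.-tuple DM4 -> DM4) :
  C (finfun g) -> C (finfun h) -> C [ffun a => meet (g a) (h a)].
Proof. by apply: clone_binary; apply: DMA_generator_in; constructor. Qed.

Lemma clone_join (n : nat) (g h : n.-tuple DM4 -> DM4) :
  C (finfun g) -> C (finfun h) -> C [ffun a => join (g a) (h a)].
Proof. by apply: clone_binary; apply: DMA_generator_in; constructor. Qed.

Lemma clone_neg (n : nat) (g : n.-tuple DM4 -> DM4) :
  C (finfun g) -> C [ffun a => dm_neg (g a)].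
Proof. by apply: clone_unary; apply: DMA_generator_in; constructor. Qed.

(** The unary constant is composed with the first projection, which exists only for positive [n]. *)
Lemma clone_const (n : nat) (c : DM4) :
  C (unary (fun=> c)) -> 0 < n -> C [ffun _ : n.-tuple DM4 => c].
Proof.
case: n => // n Cc _.
exact: (@clone_unary _ (fun=> c) (fun a => tnth a ord0) Cc (clone_var ord0)).
Qed.

Lemma clone_true (n : nat) : 0 < n -> C [ffun _ : n.-tuple DM4 => DMt].
Proof. by apply: clone_const; apply: DMA_generator_in; constructor. Qed.

Lemma clone_false (n : nat) : 0 < n -> C [ffun _ : n.-tuple DM4 => DMf].
Proof. by apply: clone_const; apply: DMA_generator_in; constructor. Qed.

(** * Sufficiency: each of the three functions yields protoalgebraicity *)

Lemma protoalgebraic_box : C (unary box) -> protoalgebraic C.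
Proof.
move=> Cbox.
have Cx : C [ffun a : 2.-tuple DM4 => tnth a ord0] := clone_var ord0.
have Cy : C [ffun a : 2.-tuple DM4 => tnth a ord_max] := clone_var ord_max.
pose d1 x y := join (dm_neg (box x)) y.
pose d2 x y := join (box (dm_neg x)) (dm_neg (box (dm_neg y))).
pose d3 x y := join (dm_neg (box (join x y))) (join (box x) (box y)).
(* On the diagonal all three are designated; [d1] separates t from n and f,
   [d2] separates b from f, and [d3] separates b from n. *)
exists [set binary d1; binary d2; binary d3]; split.
- have Cb := clone_unary Cbox.
  move=> _ [[->|->]|->].
  + by apply: clone_join => //; apply/clone_neg/Cb.
  + by apply: clone_join; [apply/Cb/clone_neg | apply/clone_neg/Cb/clone_neg].
  + apply: clone_join; first by apply/clone_neg/Cb/clone_join.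
    by apply: clone_join; apply: Cb.
- apply/(protoalgebraicP _).1 => d x.
  by case=> [[->|->]|->]; rewrite ffunE /=; case: x.
- apply/(protoalgebraicP _).2 => x y dx Dxy.
  have := Dxy (binary d1); rewrite ffunE => /(_ (or_introl (or_introl erefl))).
  have := Dxy (binary d2); rewrite ffunE => /(_ (or_introl (or_intror erefl))).
  have := Dxy (binary d3); rewrite ffunE => /(_ (or_intror erefl)).
  by move: dx; case: x {Dxy}; case: y.
Qed.

(** The singleton of [e] serves as Delta: a designated [e x y] forces [x = y], so designation passes
    from [x] to [y]. This covers both biconditionals. *)
Lemma protoalgebraic_iff (e : DM4 -> DM4 -> DM4) :
  C (binary e) -> (forall x y, is_designated (e x y) = (x == y)) ->
  protoalgebraic C.
Proof.
move=> Ce eP; exists [set binary e]; split; first by move=> _ ->.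
- by apply/(protoalgebraicP _).1 => _ x ->; rewrite ffunE eP.
- apply/(protoalgebraicP _).2 => x y dx /(_ _ erefl).
  by rewrite ffunE (eP x y) => /eqP <-.
Qed.

(** * Necessity: from Delta to one of the three functions *)

Lemma protoalgebraic_separator :
  protoalgebraic C ->
  exists d : DM4 -> DM4 -> DM4,
    [/\ C (binary d), forall x, is_designated (d x x) &
        forall x y, is_designated x -> ~~ is_designated y ->
          ~~ is_designated (d x y)].
Proof.
case=> Delta [DC /(protoalgebraicP _).1 dg /(protoalgebraicP _).2 mp].
have sep x y : is_designated x -> ~~ is_designated y ->
    exists d : DM4 -> DM4 -> DM4,
      [/\ C (binary d), forall z, is_designated (d z z) &
          ~~ is_designated (d x y)].
  (* If every member of Delta were designated at [(x, y)], detachment would designate [y]; so some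
     member fails there. *)
  move=> dx ndy; apply: contrapT => no.
  case/negP: ndy; apply: (mp x) => // d Dd.
  apply: contrapT => /negP nd; apply: no.
  exists (fun u v => d (pair_tuple u v)).
  by split=> //; [rewrite binary_eta; apply: DC | move=> z; apply: dg].
(* Only four pairs have to be separated, so a finite meet of members of Delta is enough. *)
have [d1 [C1 D1 N1]] := sep DMt DMf isT isT.
have [d2 [C2 D2 N2]] := sep DMt DMn isT isT.
have [d3 [C3 D3 N3]] := sep DMb DMf isT isT.
have [d4 [C4 D4 N4]] := sep DMb DMn isT isT.
exists (fun x y => meet (meet (d1 x y) (d2 x y)) (meet (d3 x y) (d4 x y))).
split.
- by do 2![apply: clone_meet].
- by move=> x; rewrite !is_designated_meet D1 D2 D3 D4.
- move=> x y; rewrite !is_designated_meet.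
  by case: x; case: y => // _ _;
    rewrite ?(negPf N1) ?(negPf N2) ?(negPf N3) ?(negPf N4) ?andbF.
Qed.

(** If exactly one of [x], [y] is designated, [d x y] or [d y x] fails. Otherwise distinct [x], [y]
    are t, b or f, n; negation fixes b and n and swaps t and f, so exactly one of the negations is
    designated. *)
Lemma protoalgebraic_equality :
  protoalgebraic C ->
  exists e : DM4 -> DM4 -> DM4,
    C (binary e) /\ forall x y, is_designated (e x y) = (x == y).
Proof.
case/protoalgebraic_separator=> d [Cd dg sep].
exists (fun x y => meet (meet (d x y) (d y x))
  (meet (d (dm_neg x) (dm_neg y)) (d (dm_neg y) (dm_neg x)))); split.
- have Cx : C [ffun a : 2.-tuple DM4 => tnth a ord0] := clone_var ord0.
  have Cy : C [ffun a : 2.-tuple DM4 => tnth a ord_max] := clone_var ord_max.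
  by do 2![apply: clone_meet]; apply: (clone_binary Cd) => //; apply: clone_neg.
- move=> x y; rewrite !is_designated_meet; case: eqVneq => [->|].
    by rewrite !dg.
  have nd u v : is_designated u -> ~~ is_designated v ->
      is_designated (d u v) = false by move=> du nv; apply/negbTE/sep.
  have nds := (nd DMt DMf isT isT, nd DMt DMn isT isT,
               nd DMb DMf isT isT, nd DMb DMn isT isT).
  by case: x; case: y => //= _; rewrite !nds ?andbF.
Qed.

Lemma clone_const_unary (e : DM4 -> DM4 -> DM4) (g h : 1.-tuple DM4 -> DM4)
    (c : DM4) :
  C (binary e) -> C (finfun g) -> C (finfun h) ->
  (forall a, e (g a) (h a) = c) -> C (unary (fun=> c)).
Proof.
move=> Ce Cg Ch eq_c; have := clone_binary Ce Cg Ch.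
by congr (C _); apply/ffunP => a; rewrite !ffunE.
Qed.

Lemma equality_cases (e : DM4 -> DM4 -> DM4) :
  C (binary e) -> (forall x y, is_designated (e x y) = (x == y)) ->
  C (unary box) \/ C (binary iff_tmin) \/ C (binary iff_imin).
Proof.
move=> Ce eP.
have [ett|ett] : e DMt DMt = DMt \/ e DMt DMt = DMb.
- by have := eP DMt DMt; case: (e DMt DMt) => //; [left | right].
- have [etf|etf] : e DMt DMf = DMf \/ e DMt DMf = DMn.
  + by have := eP DMt DMf; case: (e DMt DMf) => //; [left | right].
  + left.
    have Cx : C [ffun a : 1.-tuple DM4 => tnth a ord0] := clone_var ord0.
    have := clone_meet (clone_meet Cx (clone_binary Ce Cx (clone_true (ltn0Sn 0))))
      (clone_neg (clone_binary Ce Cx (clone_neg Cx))).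
    congr (C _); apply/ffunP => a; rewrite !ffunE.
    (* At t the values of [ett] and [etf] give t. Since negation fixes n and b, at n the factor
       [-e(n,n)] is f or b, whose meet with n is f; at b the factor [e(b,t)] is f or n, whose meet
       with b is f. *)
    case: (tnth a ord0) => /=.
    * by rewrite ett etf.
    * by case: (e _ _).
    * by have := eP DMn DMn; case: (e DMn DMn) => // _; case: (e _ _).
    * have := eP DMb DMt; case: (e DMb DMt) => // _;
      by have := eP DMb DMb; case: (e DMb DMb).
  + right; right.
    have Cn := clone_const_unary Ce (clone_true (ltn0Sn 0)) (clone_false (ltn0Sn 0))
      (fun=> etf).
    (* Joining with n sends t, b to t and f, n to n. *)
    have := clone_join Ce (clone_const Cn (ltn0Sn 1)).
    congr (C _); apply/ffunP => a; rewrite !ffunE /iff_imin -eP.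
    by case: (e _ _).
- right; left.
  have Cb := clone_const_unary Ce (clone_true (ltn0Sn 0)) (clone_true (ltn0Sn 0))
    (fun=> ett).
  (* Meeting with b sends t, b to b and f, n to f. *)
  have := clone_meet Ce (clone_const Cb (ltn0Sn 1)).
  congr (C _); apply/ffunP => a; rewrite !ffunE /iff_tmin -eP.
  by case: (e _ _).
Qed.

End DeMorganClone.

Theorem mainTheorem14 (C : dmfamily) (hC : is_clone C)
    (hDMA : subfamily DMA C) :
  protoalgebraic C <->
  (C 1 (unary box) \/ C 2 (binary iff_tmin) \/ C 2 (binary iff_imin)).
Proof.
split.
  by case/(protoalgebraic_equality hC hDMA)=> e [Ce eP]; apply: equality_cases eP.
case=> [|[]].
- exact: protoalgebraic_box.
- by move/protoalgebraic_iff; apply=> x y; rewrite /iff_tmin; case: eqP.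
- by move/protoalgebraic_iff; apply=> x y; rewrite /iff_imin; case: eqP.
Qed.
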